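(* Let $\Psi:(0,\infty)^2\to[0,\infty)$ be measurable and symmetric, and assume there are $\beta>0$, $k>0$ with $\Psi(\zeta,\eta)\le k(\zeta\eta)^{-\beta}$ on $(0,1)^2$, $\Psi(\zeta,\eta)\le k\eta\zeta^{-\beta}$ on $(0,1)\times(1,\infty)$, and $\Psi(\zeta,\eta)\le k(\zeta+\eta)$ on $(1,\infty)^2$. Let $T\in(0,\infty]$, let $g^{in}\in L^1_{-2\beta,1}(0,\infty)$ be non-negative, and let $g$ be a weak solution on $[0,T)$ of the Smoluchowski coagulation equation with kernel $\Psi$ and initial condition $g^{in}$. Then $\int_0^\infty\zeta g(\zeta,t)\,d\zeta=\int_0^\infty\zeta g^{in}(\zeta)\,d\zeta$ for all $t\in(0,T)$.
   Context: $L^1_{-2\beta,1}(0,\infty):=L^1((0,\infty);(\zeta^{-2\beta}+\zeta)d\zeta)$. A weak solution on $[0,T)$ is a non-negative function $g\in\mathcal{C}([0,T);L^1(0,\infty))\cap L^\infty(0,T;L^1_{-2\beta,1}(0,\infty))$ such that for every $t\in(0,T)$ and every $\omega\in L^\infty(0,\infty)$, $\int_0^\infty[g(\zeta,t)-g^{in}(\zeta)]\omega(\zeta)d\zeta=\frac12\int_0^t\int_0^\infty\int_0^\infty\tilde\omega(\zeta,\eta)\Psi(\zeta,\eta)g(\zeta,s)g(\eta,s)d\eta d\zeta ds$, where $\tilde\omega(\zeta,\eta):=\omega(\zeta+\eta)-\omega(\zeta)-\omega(\eta)$. *)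

(* Defs.v *)
From HB Require Import structures.
From mathcomp Require Import all_boot all_order all_algebra.
From mathcomp Require Import all_classical all_reals all_analysis.
Set Implicit Arguments. Unset Strict Implicit. Unset Printing Implicit Defensive.
Import Order.TTheory GRing.Theory Num.Theory.
Import numFieldNormedType.Exports.
Local Open Scope classical_set_scope.
Local Open Scope ring_scope.

Definition Rpos (R : realType) : set R := [set z : R | 0 < z].
Arguments Rpos : clear implicits.

Definition time_int (R : realType) (T : \bar R) : set R :=
  [set t : R | 0 <= t /\ (t%:E < T)%E].

Definition time_int_open (R : realType) (T : \bar R) : set R :=
  [set t : R | 0 < t /\ (t%:E < T)%E].

(* weight zeta^{-2 beta} + zeta of L^1_{-2beta,1}(0,oo) *)
Definition wgt (R : realType) (beta : R) (z : R) : R := z `^ (- (2 * beta)) + z.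

Definition L1w (R : realType) (beta : R) (f : R -> R) : Prop :=
  measurable_fun (Rpos R) f /\
  (@lebesgue_measure R).-integrable (Rpos R) (fun z => (wgt beta z * f z)%:E).

Definition weak_solution (R : realType) (beta : R) (Psi : R -> R -> R)
    (T : \bar R) (gin : R -> R) (g : R -> R -> R) : Prop :=
  let mu := @lebesgue_measure R in
  measurable_fun (Rpos R `*` time_int T) (fun p : R * R => g p.1 p.2) /\
  (forall z t, 0 < z -> time_int T t -> 0 <= g z t) /\
  (forall t, time_int T t ->
     measurable_fun (Rpos R) (fun z => g z t) /\
     mu.-integrable (Rpos R) (fun z => (g z t)%:E)) /\
  (forall t0, time_int T t0 -> forall eps : R, 0 < eps ->
     exists2 delta : R, 0 < delta & forall t, time_int T t -> `|t - t0| < delta ->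
       (\int[mu]_(z in Rpos R) (`|g z t - g z t0|)%:E < eps%:E)%E) /\
  (exists C : R, {ae mu, forall t, time_int_open T t ->
       L1w beta (fun z => g z t) /\
       (\int[mu]_(z in Rpos R) (wgt beta z * g z t)%:E <= C%:E)%E}) /\
  (forall t, time_int_open T t -> forall omega : R -> R,
     measurable_fun (Rpos R) omega ->
     (exists M : R, forall z, 0 < z -> `|omega z| <= M) ->
     (\int[mu]_(z in Rpos R) ((g z t - gin z) * omega z)%:E =
      (2^-1)%:E *
      \int[mu]_(s in [set s : R | 0 < s /\ s < t]%R)
        \int[mu]_(z in Rpos R) \int[mu]_(y in Rpos R)
          ((omega (z + y) - omega z - omega y) * Psi z y * g z s * g y s)%:E)%E).

(* Main.v *)
(** Test the equation with the truncated moment [omega_n z = min z n]. Its defect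
    [min z n + min y n - min (z + y) n] lies between 0 and [min z y] and vanishes
    as soon as [n >= z + y]. Off the null lines [z = 1] and [y = 1] one has
    [min z y * Psi z y <= 2 k w(z) w(y)] with [w(z) = z^(-2 beta) + z], and the
    weighted moment of [g] is bounded for almost every time, so dominated
    convergence in [y], [z] and [s] makes the coagulation term vanish as
    [n -> oo]. Monotone convergence then identifies the first moments of [g t]
    and [gin], without knowing beforehand that the former is finite. *)

Require Import Defs.
From HB Require Import structures.
From mathcomp Require Import all_boot all_order all_algebra.
From mathcomp Require Import all_classical all_reals all_analysis.
From mathcomp Require Import measurable_realfun ring lra.
Set Implicit Arguments. Unset Strict Implicit. Unset Printing Implicit Defensive.
Import Order.TTheory GRing.Theory Num.Theory.
Import numFieldNormedType.Exports.
Local Open Scope classical_set_scope.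
Local Open Scope ring_scope.

(** * Pointwise estimates: truncation defect, weight and kernel *)

Lemma measurable_Rpos (R : realType) : measurable (Rpos R).
Proof.
rewrite (_ : Rpos R = [set` `]0, +oo[%R])//.
by apply/seteqP; split => z; rewrite /Rpos /= in_itv/= andbT.
Qed.

(** Truncation at [A] is subadditive on positive numbers, whence the lower bound. For the upper one,
    [min (x + y) A] dominates both [min x A] and [min y A], so at most the smaller of the two
    survives the subtraction. *)
Lemma min_defect_bounds (R : realDomainType) (A x y : R) :
  0 <= A -> 0 < x -> 0 < y ->
  0 <= Num.min x A + Num.min y A - Num.min (x + y) A <= Num.min x y.
Proof.
move=> A0 x0 y0; rewrite !minElt; apply/andP.
by case: (ltP x A); case: (ltP y A); case: (ltP (x + y) A); case: (ltP x y);
  move=> *; split; lra.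
Qed.

Lemma min_defect_near0 (R : realType) (x y : R) : 0 < x -> 0 < y ->
  \forall n \near \oo,
    Num.min x n%:R + Num.min y n%:R - Num.min (x + y) n%:R = 0.
Proof.
move=> x0 y0; near=> n.
have xyn : x + y <= n%:R by near: n; exact: nbhs_infty_ger.
have xn : x <= n%:R by lra.
have yn : y <= n%:R by lra.
by rewrite !min_l//; lra.
Unshelve. all: by end_near. Qed.

Lemma wgt_gt0 (R : realType) (beta z : R) : 0 < z -> 0 < wgt beta z.
Proof. by move=> z0; rewrite /wgt addr_gt0// powR_gt0. Qed.

Lemma le_wgt (R : realType) (beta z : R) : 0 < z -> z <= wgt beta z.
Proof. by move=> z0; rewrite /wgt lerDr powR_ge0. Qed.

(** For a base below 1 the power decreases in the exponent, and [-2 beta < -beta]. *)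
Lemma powRN_le_wgt (R : realType) (beta z : R) : 0 < beta -> 0 < z < 1 ->
  z `^ (- beta) <= wgt beta z.
Proof.
move=> b0 /andP[z0 z1]; rewrite /wgt ler_wpDr ?(ltW z0)//.
by apply: ger_powR; [rewrite z0 ltW|lra].
Qed.

(** The factor [min z y] is at most 1 when both sizes are small, and at most the small size, again
    below 1, in the mixed case. For two large sizes it turns the sum [z + y] into a product, since
    [min z y * (z + y) <= 2 * (z * y)]; this is the source of the constant 2. The growth bounds hold
    on open regions only, hence the exclusion of the value 1. *)
Lemma min_kernel_bound (R : realType) (Psi : R -> R -> R) (beta k : R) :
  (forall z y, 0 < z -> 0 < y -> 0 <= Psi z y) ->
  (forall z y, 0 < z -> 0 < y -> Psi z y = Psi y z) ->
  0 < beta -> 0 < k ->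
  (forall z y, 0 < z < 1 -> 0 < y < 1 -> Psi z y <= k * (z * y) `^ (- beta)) ->
  (forall z y, 0 < z < 1 -> 1 < y -> Psi z y <= k * y * z `^ (- beta)) ->
  (forall z y, 1 < z -> 1 < y -> Psi z y <= k * (z + y)) ->
  forall z y, 0 < z -> 0 < y -> z != 1 -> y != 1 ->
    Num.min z y * Psi z y <= 2 * k * (wgt beta z * wgt beta y).
Proof.
move=> Psi0 symPsi b0 k0 Psi_ss Psi_sl Psi_ll.
have w0 z : 0 < z -> 0 < wgt beta z by exact: wgt_gt0.
have small_large z y : 0 < z < 1 -> 1 < y ->
    Num.min z y * Psi z y <= 2 * k * (wgt beta z * wgt beta y).
  move=> z01 y1; have /andP[z0 z1] := z01.
  have y0 : 0 < y by lra.
  have Psizy := Psi_sl _ _ z01 y1.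
  have wz := powRN_le_wgt b0 z01; have wy := le_wgt beta y0.
  have yzw : y * z `^ (- beta) <= wgt beta z * wgt beta y.
    by rewrite mulrC; apply: ler_pM => //; [exact: powR_ge0|exact: ltW].
  rewrite min_l; last lra.
  have := Psi0 _ _ z0 y0; have := w0 _ z0; have := w0 _ y0 => *.
  have : z * Psi z y <= 1 * (k * y * z `^ (- beta)).
    by apply: ler_pM => //; exact: ltW.
  have : k * (y * z `^ (- beta)) <= k * (wgt beta z * wgt beta y).
    by rewrite ler_wpM2l// ltW.
  have : 0 <= k * (wgt beta z * wgt beta y) by rewrite !mulr_ge0 ?ltW.
  rewrite mulrA; lra.
move=> z y z0 y0 z1 y1.
have wwk : 0 <= k * (wgt beta z * wgt beta y) by rewrite !mulr_ge0 ?ltW ?w0.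
have m0 : 0 <= Num.min z y by rewrite le_min !ltW.
have [zl1|] := ltP z 1; have [yl1|] := ltP y 1.
- have z01 : 0 < z < 1 by rewrite z0.
  have y01 : 0 < y < 1 by rewrite y0.
  have m1 : Num.min z y <= 1 by rewrite ge_min ltW.
  have : Num.min z y * Psi z y <= 1 * (k * (z * y) `^ (- beta)).
    by apply: ler_pM => //; [exact: Psi0|exact: Psi_ss].
  have : k * (z * y) `^ (- beta) <= k * (wgt beta z * wgt beta y).
    rewrite ler_wpM2l ?(ltW k0)// powRM ?(ltW z0) ?(ltW y0)//.
    by apply: ler_pM; rewrite ?powR_ge0// powRN_le_wgt.
  lra.
- rewrite le_eqVlt eq_sym (negbTE y1)/= => yg1.
  by apply: small_large => //; rewrite z0.
- rewrite le_eqVlt eq_sym (negbTE z1)/= => zg1.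
  rewrite minC symPsi// [wgt _ z * _]mulrC.
  by apply: small_large => //; rewrite y0.
- rewrite le_eqVlt eq_sym (negbTE y1)/= => yg1.
  rewrite le_eqVlt eq_sym (negbTE z1)/= => zg1.
  have zyw : k * (z * y) <= k * (wgt beta z * wgt beta y).
    by rewrite ler_wpM2l ?(ltW k0)//; apply: ler_pM; rewrite ?le_wgt// ltW.
  have : Num.min z y * Psi z y <= Num.min z y * (k * (z + y)).
    by rewrite ler_wpM2l// Psi_ll.
  have : Num.min z y * (z + y) <= 2 * (z * y).
    by case: (leP z y) => zy; nra.
  by move=> /(ler_wpM2l (ltW k0)); lra.
Qed.

(** * Convergence theorems for the integrals involved *)

Lemma ge0_dominated_cvg0 d (T : measurableType d) (R : realType)
    (mu : {measure set T -> \bar R}) (D : set T)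
    (f : nat -> T -> \bar R) (b : T -> \bar R) :
  measurable D -> (forall n, measurable_fun D (f n)) ->
  (forall n x, D x -> (0 <= f n x)%E) ->
  {ae mu, forall x, D x -> f n x @[n --> \oo] --> 0%E} ->
  mu.-integrable D b ->
  {ae mu, forall x, forall n, D x -> (f n x <= b x)%E} ->
  (\int[mu]_(x in D) f n x)%E @[n --> \oo] --> 0%E.
Proof.
move=> mD mf f0 fcvg ib fb.
have [|_ _] := @dominated_convergence _ _ _ mu _ mD f (cst 0%E) b
  mf (measurable_cst _) fcvg ib.
  apply: filterS fb => x fb n Dx; rewrite gee0_abs ?f0//; exact: fb.
by rewrite integral0.
Qed.

(** The majorant has product form: integrating [c * G s x * G s y] in [y] leaves at most
    [c * C * G s x], and then in [x] at most [c * C * C], a constant, integrable over the finite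
    measure of [D]. Dominated convergence thus applies three times, from the inside out. The
    exceptional sets in [x] and [y] must not depend on [n] or [s], which fixes the order of the
    quantifiers. *)
Lemma triple_integral_cvg0 d1 d2 (S : measurableType d1)
    (X : measurableType d2) (R : realType)
    (nu : {measure set S -> \bar R}) (mu : {sigma_finite_measure set X -> \bar R})
    (D : set S) (H : nat -> S -> X -> X -> R) (G : S -> X -> R) (c C : R) :
  measurable D -> (nu D < +oo)%E ->
  (forall n, measurable_fun setT (fun p : S * X * X => H n p.1.1 p.1.2 p.2)) ->
  measurable_fun setT (fun p : S * X => G p.1 p.2) ->
  (forall n s x y, 0 <= H n s x y) -> (forall s x, 0 <= G s x) -> 0 <= c ->
  (forall s x y, H n s x y @[n --> \oo] --> 0) ->
  {ae mu, forall x, {ae mu, forall y, forall n s,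
    H n s x y <= c * (G s x * G s y)}} ->
  {ae nu, forall s, D s -> (\int[mu]_x (G s x)%:E <= C%:E)%E} ->
  (\int[nu]_(s in D) \int[mu]_x \int[mu]_y (H n s x y)%:E)%E
    @[n --> \oo] --> 0%E.
Proof.
move=> mD Doo mH mG H0 G0 c0 Hcvg HG GC.
(* [F] and [E] are the inner integrals over one and two space variables; Tonelli makes them
   measurable in the remaining ones. *)
pose F n (p : S * X) : \bar R := (\int[mu]_y (H n p.1 p.2 y)%:E)%E.
have F0 n p : (0 <= F n p)%E.
  by apply: integral_ge0 => y _; rewrite lee_fin.
have mF n : measurable_fun setT (F n).
  apply: (measurable_fun_fubini_tonelli_F
    (fun p : S * X * X => (H n p.1.1 p.1.2 p.2)%:E)) => [|p].
    by apply/measurable_EFinP; exact: mH.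
  by rewrite lee_fin.
pose E n s : \bar R := (\int[mu]_x F n (s, x))%E.
have E0 n s : (0 <= E n s)%E by exact: integral_ge0.
have mE n : measurable_fun setT (E n).
  exact: (measurable_fun_fubini_tonelli_F (F n)).
have mG_ s : measurable_fun setT (G s).
  exact: (measurableT_comp mG (pair1_measurable s)).
have mH_ n s x : measurable_fun setT (H n s x).
  exact: (measurableT_comp (mH n) (pair1_measurable (s, x))).
have mF_ n s : measurable_fun setT (fun x => F n (s, x)).
  exact: (measurableT_comp (mF n) (pair1_measurable s)).
have iG s : (\int[mu]_x (G s x)%:E <= C%:E)%E ->
    mu.-integrable setT (fun x => (G s x)%:E).
  move=> GsC; apply/integrableP; split; first exact/measurable_EFinP.
  rewrite (eq_integral (fun x => (G s x)%:E)); last first.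
    by move=> x _; rewrite gee0_abs// lee_fin.
  exact: le_lt_trans GsC (ltry _).
have iGc s x : (\int[mu]_x (G s x)%:E <= C%:E)%E ->
    mu.-integrable setT (fun y => (c * (G s x * G s y))%:E).
  move=> /iG iGs.
  rewrite (_ : (fun _ => _) = (fun y => (c * G s x)%:E * (G s y)%:E)%E).
    exact: integrableZl.
  by apply/funext => y; rewrite -EFinM mulrA.
have FG s : (\int[mu]_x (G s x)%:E <= C%:E)%E ->
    {ae mu, forall x, forall n, setT x -> (F n (s, x) <= (c * C)%:E * (G s x)%:E)%E}.
  move=> GsC; apply: filterS HG => x HG n _.
  apply: (@le_trans _ _ (\int[mu]_y ((c * G s x)%:E * (G s y)%:E))%E).
    apply: ae_ge0_le_integral => //.
    - by move=> y _; rewrite lee_fin.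
    - exact/measurable_EFinP.
    - by move=> y _; rewrite -EFinM lee_fin !mulr_ge0.
    - by apply/measurable_EFinP; exact: measurable_funM.
    - apply: filterS HG => y HG _.
      by rewrite -EFinM lee_fin -mulrA; exact: HG.
  rewrite ge0_integralZl_EFin ?mulr_ge0//; last 2 first.
  - by move=> y _; rewrite lee_fin.
  - exact/measurable_EFinP.
  by rewrite -EFinM mulrAC [leRHS]EFinM lee_wpmul2l// lee_fin mulr_ge0.
have Fcvg s : (\int[mu]_x (G s x)%:E <= C%:E)%E ->
    {ae mu, forall x, setT x -> F n (s, x) @[n --> \oo] --> 0%E}.
  move=> GsC; apply: filterS HG => x HG _.
  apply: (@ge0_dominated_cvg0 _ _ _ mu setT _
    (fun y => (c * (G s x * G s y))%:E)) => //.
  - by move=> n; exact/measurable_EFinP.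
  - by move=> n y _; rewrite lee_fin.
  - apply: aeW => y _; apply: cvg_EFin; last exact: Hcvg.
    by apply: nearW.
  - exact: iGc.
  - by apply: filterS HG => y HG n _; rewrite lee_fin.
have iGC s : (\int[mu]_x (G s x)%:E <= C%:E)%E ->
    mu.-integrable setT (fun x => (c * C)%:E * (G s x)%:E)%E.
  by move=> /iG; exact: integrableZl.
apply: (@ge0_dominated_cvg0 _ _ _ nu D E (cst (c * C * C)%:E)) => //.
- by move=> n; exact: measurable_funTS.
- apply: filterS GC => s GC /GC GsC.
  apply: (@ge0_dominated_cvg0 _ _ _ mu setT (fun n x => F n (s, x))) => //.
  - exact: Fcvg.
  - exact: (iGC _ GsC).
  - exact: FG.
- apply/integrableP; split; first exact: measurable_cst.
  by rewrite integral_cst// lte_mul_pinfty.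
- apply: filterS GC => s GC n /GC GsC.
  (* The sign of [C] comes from its being an upper bound for the integral of the nonnegative
     [G s]. *)
  have C0 : 0 <= C.
    by rewrite -lee_fin (le_trans _ GsC)// integral_ge0// => x _; rewrite lee_fin.
  apply: (@le_trans _ _ (\int[mu]_x ((c * C)%:E * (G s x)%:E))%E).
    apply: ae_ge0_le_integral => //.
    - by move=> x _; rewrite -EFinM lee_fin !mulr_ge0.
    - by apply/measurable_EFinP; exact: measurable_funM.
    - by apply: filterS (FG _ GsC) => x; apply.
  rewrite ge0_integralZl_EFin ?mulr_ge0//; last 2 first.
  - by move=> y _; rewrite lee_fin.
  - exact/measurable_EFinP.
  by rewrite [leRHS]EFinM lee_wpmul2l// lee_fin mulr_ge0.
Qed.

(** Monotone convergence: the truncations increase to [z] and are stationary from [n >= z] on. The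
    limit is taken in the extended reals, so an infinite moment is allowed. *)
Lemma cvg_integral_min (R : realType) (f : R -> R) :
  measurable_fun (Rpos R) f -> (forall z, 0 < z -> 0 <= f z) ->
  (\int[@lebesgue_measure R]_(z in Rpos R) (f z * Num.min z n%:R)%:E)%E
    @[n --> \oo] --> (\int[@lebesgue_measure R]_(z in Rpos R) (z * f z)%:E)%E.
Proof.
move=> mf f0.
have -> : (\int[@lebesgue_measure R]_(z in Rpos R) (z * f z)%:E =
    \int[@lebesgue_measure R]_(z in Rpos R)
      limn (fun n => (f z * Num.min z n%:R)%:E))%E.
  apply: eq_integral => z _; apply/esym/cvg_lim => //.
  apply: cvg_near_cst; near=> n; rewrite min_l 1?mulrC//.
  by near: n; exact: nbhs_infty_ger.
apply: cvg_monotone_convergence.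
- exact: measurable_Rpos.
- move=> n; apply/measurable_EFinP/measurable_funM => //.
  exact: measurable_minr.
- by move=> n z z0; rewrite lee_fin mulr_ge0 ?f0// le_min ler0n ltW.
- move=> z z0 m n mn; rewrite lee_fin ler_wpM2l ?f0//.
  by rewrite le_min !ge_min lexx/= ler_nat mn orbT.
Unshelve. all: by end_near. Qed.

(** * The coagulation term for truncated test functions *)

Local Notation mu := (@lebesgue_measure _).

Section truncated_coagulation.
Context (R : realType) (Psi : R -> R -> R) (g : R -> R -> R) (t : R).
Hypothesis mPsi : measurable_fun (Rpos R `*` Rpos R) (fun p : R * R => Psi p.1 p.2).
Hypothesis Psi_ge0 : forall z y, 0 < z -> 0 < y -> 0 <= Psi z y.
Let I := [set s : R | 0 < s /\ s < t].
Hypothesis mg : measurable_fun (Rpos R `*` I) (fun p : R * R => g p.1 p.2).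
Hypothesis g_ge0 : forall z s, 0 < z -> I s -> 0 <= g z s.

Let I_itv : I = [set` `]0, t[%R].
Proof. by apply/seteqP; split => s; rewrite /I /= in_itv/= => /andP. Qed.

Let mI : measurable I.
Proof. by rewrite I_itv. Qed.

(** Extension by zero makes the kernel and the solution measurable on the whole plane, as Tonelli on
    full product spaces requires. *)
Let Psi0 : R * R -> R := (fun p => Psi p.1 p.2) \_ (Rpos R `*` Rpos R).
Let g0 : R * R -> R := (fun p => g p.1 p.2) \_ (Rpos R `*` I).

Let mPsi0 : measurable_fun setT Psi0.
Proof.
apply/(measurable_restrictT _ _).1 => //.
by apply: measurableX; exact: measurable_Rpos.
Qed.

Let mg0 : measurable_fun setT g0.
Proof.
apply/(measurable_restrictT _ _).1 => //.
by apply: measurableX => //; exact: measurable_Rpos.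
Qed.

Let Psi0E z y : 0 < z -> 0 < y -> Psi0 (z, y) = Psi z y.
Proof. by move=> z0 y0; rewrite /Psi0 patchE mem_set. Qed.

Let g0E z s : 0 < z -> I s -> g0 (z, s) = g z s.
Proof. by move=> z0 Is; rewrite /g0 patchE mem_set. Qed.

Let g0_out z s : ~ (0 < z /\ I s) -> g0 (z, s) = 0.
Proof. by move=> zs; rewrite /g0 patchE memNset. Qed.

Let g0_ge0 z s : 0 <= g0 (z, s).
Proof.
have [[z0 Is]|/g0_out->//] := pselect (0 < z /\ I s).
by rewrite g0E// g_ge0.
Qed.

(** The integrand with its sign reversed, so that it is nonnegative. Outside the domain it vanishes
    through the factors [g0]. *)
Let H n s z y : R :=
  (Num.min z n%:R + Num.min y n%:R - Num.min (z + y) n%:R) *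
  Psi0 (z, y) * g0 (z, s) * g0 (y, s).

Let H_out n s z y : ~ [/\ 0 < z, 0 < y & I s] -> H n s z y = 0.
Proof.
move=> zys; rewrite /H.
have [[z0 Is]|/g0_out->] := pselect (0 < z /\ I s); last by rewrite mulr0 mul0r.
by rewrite (@g0_out y s) ?mulr0// => -[y0 _]; exact: zys.
Qed.

Let H_ge0 n s z y : 0 <= H n s z y.
Proof.
have [[z0 y0 Is]|/H_out->//] := pselect [/\ 0 < z, 0 < y & I s].
have /andP[d0 _] := min_defect_bounds (ler0n R n) z0 y0.
by rewrite /H !mulr_ge0// Psi0E// Psi_ge0.
Qed.

Let mH n : measurable_fun setT (fun p : R * R * R => H n p.1.1 p.1.2 p.2).
Proof.
have m1 : measurable_fun setT (fun p : R * R * R => p.1.1) by exact: measurableT_comp.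
have m2 : measurable_fun setT (fun p : R * R * R => p.1.2) by exact: measurableT_comp.
have m3 : measurable_fun setT (fun p : R * R * R => p.2) by exact: measurable_snd.
rewrite /H; do 3 ?apply: measurable_funM.
- apply: measurable_funB; first apply: measurable_funD.
  + exact: measurable_minr.
  + exact: measurable_minr.
  + by apply: measurable_minr => //; exact: measurable_funD.
- by apply: (measurableT_comp mPsi0); exact: measurable_fun_pair.
- by apply: (measurableT_comp mg0); exact: measurable_fun_pair.
- by apply: (measurableT_comp mg0); exact: measurable_fun_pair.
Qed.

(** The sign passes through each of the three integrals because [H] is nonnegative, and the two
    domains of integration agree because [H] vanishes off the positive half-line. *)
Lemma coagulation_minE n :
  (\int[mu]_(s in I) \int[mu]_(z in Rpos R) \int[mu]_(y in Rpos R)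
     ((Num.min (z + y) n%:R - Num.min z n%:R - Num.min y n%:R)
       * Psi z y * g z s * g y s)%:E =
   - \int[mu]_(s in I) \int[mu]_z \int[mu]_y (H n s z y)%:E)%E.
Proof.
rewrite -integral_ge0N; last first.
  by move=> s _; do 2 (apply: integral_ge0 => ? _); rewrite lee_fin.
apply: eq_integral => s; rewrite inE => Is.
rewrite -integral_ge0N; last first.
  by move=> z _; apply: integral_ge0 => ? _; rewrite lee_fin.
rewrite [LHS]integral_mkcond; apply: eq_integral => z _.
rewrite -integral_ge0N; last by move=> y _; rewrite lee_fin.
rewrite patchE; case: ifPn; rewrite ?inE ?notin_setE => z0; last first.
  by rewrite integral0_eq// => y _; rewrite H_out ?oppe0// => -[].
rewrite [LHS]integral_mkcond; apply: eq_integral => y _.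
rewrite patchE; case: ifPn; rewrite ?inE ?notin_setE => y0; last first.
  by rewrite H_out ?oppe0// => -[].
by rewrite -EFinN /H Psi0E// !g0E//; congr EFin; ring.
Qed.

Lemma coagulation_min_cvg0 (beta c C : R) : 0 <= c ->
  (forall z y, 0 < z -> 0 < y -> z != 1 -> y != 1 ->
    Num.min z y * Psi z y <= c * (wgt beta z * wgt beta y)) ->
  {ae mu, forall s, I s ->
    (\int[mu]_(z in Rpos R) (wgt beta z * g z s)%:E <= C%:E)%E} ->
  (\int[mu]_(s in I) \int[mu]_(z in Rpos R) \int[mu]_(y in Rpos R)
     ((Num.min (z + y) n%:R - Num.min z n%:R - Num.min y n%:R)
       * Psi z y * g z s * g y s)%:E)%E @[n --> \oo] --> 0%E.
Proof.
move=> c0 kernel_bound moment_bound.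
under eq_fun do rewrite coagulation_minE.
rewrite -(@oppe0 R); apply: cvgeN.
have ae_filter := ae_filter_ringOfSetsType (@lebesgue_measure R).
have ae_neq1 : {ae (@lebesgue_measure R), forall z, z != 1}.
  exists [set 1]; split => //; first exact: lebesgue_measure_set1.
  by move=> z /= /negP; rewrite negbK => /eqP.
apply: (@triple_integral_cvg0 _ _ _ _ _ mu mu I H
  (fun s z => wgt beta z * g0 (z, s)) c C) => //.
- rewrite I_itv -[X in (X < _)%E]/(mu ([set` `]0, t[%R] : set R)).
  by rewrite lebesgue_measure_itv/=; case: ifPn => // _;
    rewrite -EFinB ltry.
- apply: measurable_funM.
    apply: measurable_funD => //.
    exact: (measurableT_comp (measurable_powR _)).
  by apply: (measurableT_comp mg0); exact: measurable_fun_pair.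
(* The sign of the weight is not controlled for [z <= 0]; there the product is zero because [g0]
   is. *)
- move=> s z; have [[z0 Is]|/g0_out->] := pselect (0 < z /\ I s); last by rewrite mulr0.
  by rewrite mulr_ge0// ltW// wgt_gt0.
- move=> s z y; have [[z0 y0 Is]|zys] := pselect [/\ 0 < z, 0 < y & I s].
    apply: cvg_near_cst; apply: filterS (min_defect_near0 z0 y0) => n d0.
    by rewrite /H d0 !mul0r.
  by under eq_fun do rewrite H_out//; exact: cvg_cst.
(* The exceptional set is [{1}] in each variable, whatever [n] and [s]. *)
- apply: filterS (ae_neq1) => z z1; apply: filterS (ae_neq1) => y y1 n s.
  have [[z0 y0 Is]|zys] := pselect [/\ 0 < z, 0 < y & I s]; last first.
    rewrite H_out// mulr_ge0//.
    have [[z0 Is]|/g0_out->] := pselect (0 < z /\ I s); last by rewrite mulr0 mul0r.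
    by rewrite (@g0_out y s) ?mulr0// => -[y0 _]; exact: zys.
  have /andP[_ dm] := min_defect_bounds (ler0n R n) z0 y0.
  have -> : c * (wgt beta z * g0 (z, s) * (wgt beta y * g0 (y, s))) =
    c * (wgt beta z * wgt beta y) * g0 (z, s) * g0 (y, s) by ring.
  rewrite /H Psi0E// !ler_wpM2r//.
  apply: le_trans (kernel_bound _ _ z0 y0 z1 y1).
  by rewrite ler_wpM2r// Psi_ge0.
- apply: filterS moment_bound => s moment_bound Is.
  apply: le_trans (moment_bound Is).
  rewrite [leRHS]integral_mkcond.
  rewrite le_eqVlt; apply/orP; left; apply/eqP; apply: eq_integral => z _.
  rewrite patchE; case: ifPn; rewrite ?inE ?notin_setE => z0; first by rewrite g0E.
  by rewrite g0_out ?mulr0// => -[].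
Qed.

End truncated_coagulation.

(** * Passage to the limit in the truncated mass balance *)

Theorem theorem3p1 (R : realType) (Psi : R -> R -> R) (beta k : R)
  (T : \bar R) (gin : R -> R) (g : R -> R -> R) :
  measurable_fun (Rpos R `*` Rpos R) (fun p : R * R => Psi p.1 p.2) ->
  (forall z y, 0 < z -> 0 < y -> 0 <= Psi z y) ->
  (forall z y, 0 < z -> 0 < y -> Psi z y = Psi y z) ->
  0 < beta -> 0 < k ->
  (forall z y, 0 < z < 1 -> 0 < y < 1 -> Psi z y <= k * (z * y) `^ (- beta)) ->
  (forall z y, 0 < z < 1 -> 1 < y -> Psi z y <= k * y * z `^ (- beta)) ->
  (forall z y, 1 < z -> 1 < y -> Psi z y <= k * (z + y)) ->
  (0 < T)%E ->
  L1w beta gin ->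
  (forall z, 0 < z -> 0 <= gin z) ->
  weak_solution beta Psi T gin g ->
  forall t, 0 < t -> (t%:E < T)%E ->
    (\int[@lebesgue_measure R]_(z in Rpos R) (z * g z t)%:E =
     \int[@lebesgue_measure R]_(z in Rpos R) (z * gin z)%:E)%E.
Proof.
move=> mPsi Psi_ge0 symPsi beta0 k0 Psi_ss Psi_sl Psi_ll T0 [mgin igin] gin_ge0.
move=> [mg [g_ge0 [g_int [_ [[C g_bound] weak]]]]] t t0 tT.
have tI : time_int T t by split => //; exact: ltW.
have ae_filter := ae_filter_ringOfSetsType (@lebesgue_measure R).
have mRpos : measurable (Rpos R) by exact: measurable_Rpos.
have time_lt s : 0 < s /\ s < t -> time_int_open T s.
  by move=> [s0 st]; split => //; apply: lt_trans tT; rewrite lte_fin.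
have min_n n z : 0 < z -> 0 <= Num.min z n%:R :> R.
  by move=> z0; rewrite le_min ler0n ltW.
have mmin n : measurable_fun (Rpos R) (fun z : R => Num.min z n%:R).
  exact: measurable_minr.
have [mgt igt] := g_int _ tI.
have gt_ge0 z : 0 < z -> 0 <= g z t by move=> z0; exact: g_ge0.
(* At the fixed time [t] only integrability of [g] is used: the truncation is bounded by [n]. *)
have ig_min n : mu.-integrable (Rpos R) (fun z => (g z t * Num.min z n%:R)%:E).
  apply: (@le_integrable _ _ _ mu _ mRpos _ (fun z => n%:R%:E * (g z t)%:E)%E).
  - by apply/measurable_EFinP; exact: (measurable_funM mgt (mmin n)).
  - move=> z z0; rewrite -EFinM !abse_EFin lee_fin !ger0_norm ?mulr_ge0 ?min_n ?gt_ge0//.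
    by rewrite mulrC ler_wpM2r ?gt_ge0// ge_min lexx orbT.
  - exact: integrableZl.
(* For the initial datum the majorant is the weighted one, through [min z n <= z <= wgt beta z]. *)
have igin_min n : mu.-integrable (Rpos R) (fun z => (gin z * Num.min z n%:R)%:E).
  apply: (@le_integrable _ _ _ mu _ mRpos _ (fun z => (wgt beta z * gin z)%:E)) => //.
  - by apply/measurable_EFinP; exact: (measurable_funM mgin (mmin n)).
  - move=> z z0; have w0 := ltW (wgt_gt0 beta z0).
    rewrite !abse_EFin lee_fin !ger0_norm ?mulr_ge0 ?min_n ?gin_ge0//.
    rewrite mulrC ler_wpM2r ?gin_ge0// (le_trans _ (le_wgt beta z0))//.
    by rewrite ge_min lexx.
pose K n : \bar R := (\int[mu]_(s in [set s : R | 0 < s /\ s < t]%R)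
  \int[mu]_(z in Rpos R) \int[mu]_(y in Rpos R)
    ((Num.min (z + y) n%:R - Num.min z n%:R - Num.min y n%:R)
      * Psi z y * g z s * g y s)%:E)%E.
have K0 : K n @[n --> \oo] --> 0%E.
  apply: (@coagulation_min_cvg0 _ _ _ _ _ _ _ _ beta (2 * k) C) => //.
  - apply: measurable_funS mg; last first.
      by move=> [z s] /= [z0 /time_lt[s0 sT]]; do 2 split => //; exact: ltW.
    apply: measurableX => //.
    (* Restricting measurability from [time_int T] to times in [(0, t)] needs the larger set
       measurable; it is a bounded or unbounded interval according to [T]. *)
    case: (T) T0 => [r| |]//= _.
    + rewrite (_ : time_int _ = [set` `[0, r[%R])//.
      by apply/seteqP; split => s; rewrite /time_int /= in_itv/= lte_fin => /andP.
    + rewrite (_ : time_int _ = [set` `[0, +oo[%R])//.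
      apply/seteqP; split => s; rewrite /time_int /= in_itv/= andbT; first by case.
      by move=> s0; split => //; rewrite ltry.
  - by move=> z s z0 /time_lt[s0 sT]; apply: g_ge0 => //; split => //; exact: ltW.
  - by rewrite mulr_ge0// ltW.
  - exact: min_kernel_bound.
  - by apply: filterS g_bound => s g_bound /time_lt/g_bound[].
(* The weak formulation with the test function [min z n], bounded by [n]. Both truncated moments are
   finite, so the integral of the difference splits and the initial moment can be moved across. *)
have balance n : (\int[mu]_(z in Rpos R) (g z t * Num.min z n%:R)%:E =
    \int[mu]_(z in Rpos R) (gin z * Num.min z n%:R)%:E + (2^-1)%:E * K n)%E.
  rewrite /K -(weak t (conj t0 tT) (fun z => Num.min z n%:R)) => //; last first.
    exists n%:R => z z0.
    by rewrite ger0_norm ?min_n// ge_min lexx orbT.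
  under [X in (_ + X)%E]eq_integral do rewrite mulrBl EFinB.
  rewrite integralB_EFin//; [|exact: ig_min|exact: igin_min].
  rewrite addeC subeK//.
  exact: integrable_fin_num (igin_min n).
have /cvg_lim <- // := cvg_integral_min mgt gt_ge0.
have K20 : ((2^-1)%:E * K n)%E @[n --> \oo] --> 0%E.
  by have := cvgeZl (isT : (2^-1 : R)%:E \is a fin_num) K0; rewrite mule0.
apply/cvg_lim => //; under eq_fun do rewrite balance.
(* The second limit is the finite value 0, so the sum of limits is well defined. *)
by have := cvgeD (fin_num_adde_defl _ (isT : (0 : \bar R) \is a fin_num)) 
    (cvg_integral_min mgin gin_ge0) K20; rewrite adde0; apply.
Qed.
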